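(* Let $(X,d)$ be a metric space, $(P,\rho)$ a separable metric space, $Q$ a fixed countable dense subset of $P$, and $Z:=X\times P$ with a usual product metric. Let $l\ge 1$ be an integer, let $G$ be a set-valued mapping assigning to each $z\in Z$ a subset $G(z)\subset X^l$, and let $\Phi:Z\times X^l\to\mathbb{R}\cup\{+\infty\}$ be a function. Suppose that the following hold. (A1.1) For every $z=(x,p)\in Z$ the set $G(z)$ is nonempty, and for any $u\in G(z)$ and any sequence $(x_n)_n\subset X$ converging to $x$ there is a sequence $(p_n)_n\subset Q$ such that $p_n\to p$ and, with $z_n:=(x_n,p_n)$, one has $u\in G(z_n)\subset G(z)$ for all sufficiently large $n$. (A2.1) For every $z\in Z$ and any $u\in G(z)$, if $(z_n)_n\subset Z$ converges to $z$, then $\Phi(z_n,u)\to\Phi(z,u)$. (A2.2) For every $z\in Z$, for any nonempty set $A\subset X^l$ which intersects $G(z)$ and for any sequence $(z_n)_n\subset Z$ converging to $z$, $$\limsup_{n\to\infty}\ \sup\{\Phi(z_n,u): u\in A\cap G(z)\}\le \sup\{\Phi(z,u): u\in A\cap G(z)\}.$$ Let $\mathcal{R}$ be the family of all closed separable subspaces $Y$ of $X$ such that for every $x\in Y$ and every $p\in P$ we have, for $z=(x,p)$, that $Y^l\cap G(z)\neq\emptyset$ and $$\sup\{\Phi(z,u): u\in G(z)\}=\sup\{\Phi(z,u): u\in Y^l\cap G(z)\}.$$ Then $\mathcal{R}$ is a rich family.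
   Context: ''Closed separable subspace'' of a metric space $X$ means a closed subset that is separable in the induced metric. A family $\mathcal{R}$ of closed separable subspaces of $X$ is called rich if: (i) (cofinality) for every separable subspace $Y_0$ of $X$ there is $Y\in\mathcal{R}$ with $Y_0\subset Y$; (ii) ($\sigma$-closedness) if $(Y_i)_{i\ge1}$ is an increasing sequence of elements of $\mathcal{R}$ (i.e. $Y_i\subset Y_{i+1}$ for all $i$), then $\overline{\bigcup_{i\ge1}Y_i}\in\mathcal{R}$. Suprema, limits and limsup are taken in the extended real line. *)

(* Defs.v *)
From HB Require Import structures.
From mathcomp Require Import all_boot all_order all_algebra.
From mathcomp Require Import all_classical all_reals all_analysis.

Set Implicit Arguments.
Unset Strict Implicit.
Unset Printing Implicit Defensive.

Import Order.TTheory GRing.Theory Num.Theory.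
Import numFieldNormedType.Exports.

Local Open Scope classical_set_scope.
Local Open Scope ring_scope.

(* Separability of Y in the induced topology: the closure of C relative to Y
   is closure C `&` Y, so "C is dense in Y" reads Y `<=` closure C. *)
Definition separable (T : topologicalType) (Y : set T) : Prop :=
  exists C : set T, [/\ countable C, C `<=` Y & Y `<=` closure C].

Definition closed_separable (T : topologicalType) (Y : set T) : Prop :=
  closed Y /\ separable Y.

Definition rich_family (T : topologicalType) (F : set (set T)) : Prop :=
  [/\ F `<=` @closed_separable T,
      (forall Y0 : set T, separable Y0 -> exists2 Y, F Y & Y0 `<=` Y)
    & (forall Y : nat -> set T, (forall i, F (Y i)) ->
        (forall i, Y i `<=` Y i.+1) -> F (closure (\bigcup_i Y i)))].

(* The l-fold Cartesian power Y^l, as a subset of T^l = 'I_l -> T. *)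
Definition set_power (T : Type) (l : nat) (Y : set T) : set ('I_l -> T) :=
  [set u | forall i, Y (u i)].

Definition sup_determining_family (R : realType) (X P : metricType R) (l : nat)
    (G : X * P -> set ('I_l -> X)) (Phi : X * P -> ('I_l -> X) -> \bar R) :
    set (set X) :=
  [set Y | closed_separable Y /\
    forall (x : X) (p : P), Y x ->
      set_power Y `&` G (x, p) !=set0 /\
      ereal_sup [set Phi (x, p) u | u in G (x, p)] =
      ereal_sup [set Phi (x, p) u | u in set_power Y `&` G (x, p)]].

(* Main.v *)
Require Import Defs.
From HB Require Import structures.
From mathcomp Require Import all_boot all_order all_algebra.
From mathcomp Require Import all_classical all_reals all_analysis.
Import Order.TTheory GRing.Theory Num.Theory.
Import numFieldNormedType.Exports.
Local Open Scope classical_set_scope.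
Local Open Scope ring_scope.

(** The heart of the matter is that the two requirements on a member of the
    family (feasible points with entries in the subspace exist, and they
    realise the supremum) pass from a set [D] to [closure D]: see
    [sup_attained_on_closure].  Given [x] in [closure D], a parameter [p] and
    [u] in [G (x, p)], take [x_ n] in [D] converging to [x], and then [p_ n] in
    [Q] converging to [p] with [u] in [G (x_ n, p_ n)] and
    [G (x_ n, p_ n)] inside [G (x, p)] for large [n].  Points of
    [D^l] feasible at [(x_ n, p_ n)] are then feasible at [(x, p)], and
    [[
      Phi (x_ n, p_ n) u <= sup of Phi (x_ n, p_ n) over G (x_ n, p_ n)
                         <= sup of Phi (x_ n, p_ n) over D^l & G (x_ n, p_ n)
                         <= sup of Phi (x_ n, p_ n) over (closure D)^l & G (x, p).
    ]]
    Continuity of [Phi] at [u] on the left and the upper semicontinuity of the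
    suprema on the right bound [Phi (x, p) u] by the supremum of [Phi (x, p)]
    over [(closure D)^l & G (x, p)].

    Only parameters in the countable set [Q] are tested on [D], so [D] can be
    chosen countable: attach to every [z] a countable nonempty part of [G z]
    with the same supremum ([countable_sup_attaining]), and close a countable
    dense subset of the given separable subspace under the operation that adds
    the entries of these points ([countable_closed_under]).  The closure of [D]
    is the member sought in the cofinality axiom.  For sigma-closedness, [D] is
    the union of the sequence: a point of [D] lies in some [Y i], where the
    supremum is already attained on [(Y i)^l], which is contained in [D^l]. *)

Lemma closure_cvg_seq (R : realType) (X : metricType R) (D : set X) (x : X) :
  closure D x ->
  exists2 x_ : nat -> X, forall n, D (x_ n) & x_ n @[n --> \oo] --> x.
Proof.
move=> Dx.
have /choice[x_ x_P] (n : nat) : exists y, D y /\ ball x n.+1%:R^-1 y.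
  by have [y [Dy xy]] := Dx _ (nbhsx_ballx x n.+1%:R^-1 ltac:(by [])); exists y.
exists x_; first by move=> n; have [] := x_P n.
apply/cvg_ballP => e e0; near=> n.
apply: (@le_ball _ _ _ n.+1%:R^-1); last by have [] := x_P n.
by apply: ltW; near: n; exact: (near_infty_natSinv_lt (PosNum e0)).
Unshelve. all: by end_near. Qed.

(** Only the tails of the two sequences matter: each set [V] in the infimum
    defining the right-hand side can be intersected with the set where the
    inequality holds. *)
Lemma le_limn_esup (R : realType) (u v : nat -> \bar R) :
  (\forall n \near \oo, (u n <= v n)%E) -> (limn_esup u <= limn_esup v)%E.
Proof.
move=> uv; apply: le_ereal_inf_tmp => _ [V ooV <-].
apply: (@le_trans _ _ (ereal_sup (u @` (V `&` [set n | (u n <= v n)%E])))).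
  by apply: ereal_inf_lbound; eexists => //; exact: filterI.
apply: ge_ereal_sup => _ [n [Vn un] <-]; apply: (le_trans un).
by apply: ereal_sup_ubound; exists n.
Qed.

(** The supremum of a nonempty set of extended reals is the limit of a sequence
    in that set; [E] consists of preimages of its terms.  [E] is also required
    to be nonempty because a supremum equal to [-oo] would not ensure it. *)
Lemma countable_sup_attaining (R : realType) (U : Type) (f : U -> \bar R)
    (S : set U) : S !=set0 ->
  exists E : set U, [/\ countable E, E `<=` S, E !=set0 &
    (ereal_sup (f @` S) <= ereal_sup (f @` E))%E].
Proof.
move=> [u0 Su0].
have fS0 : f @` S != set0 by apply/set0P; exists (f u0); exists u0.
have [y yS y_cvg] := ereal_sup_seq fS0.
have /choice[u uP] (n : nat) : exists v, S v /\ f v = y n.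
  by have [v Sv fv] := yS n; exists v.
exists (range u); split.
- exact: card_image_le.
- by move=> _ [n _ <-]; have [] := uP n.
- by exists (u 0); exists 0.
- rewrite -(cvg_lim _ y_cvg)//; apply: lime_le; first exact: (cvgP _ y_cvg).
  apply: nearW => n; apply: ereal_sup_ubound.
  by exists (u n); [exists n | have [] := uP n].
Qed.

(** [C] collects the [n]-fold iterates, for all [n], of the map
    [A |-> \bigcup_(x in A) S x] from [C0]; each one is countable, and [S] sends
    the [n]-th one into the next. *)
Lemma countable_closed_under (T : Type) (S : T -> set T) (C0 : set T) :
  countable C0 -> (forall x, countable (S x)) ->
  exists C : set T, [/\ countable C, C0 `<=` C &
    forall x, C x -> S x `<=` C].
Proof.
move=> C0_countable S_countable.
pose C_ n := iter n (fun A => \bigcup_(x in A) S x) C0.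
exists (\bigcup_n C_ n); split.
- apply: bigcup_countable => // n _; elim: n => [//|n IHn].
  exact: bigcup_countable.
- by move=> x C0x; exists 0.
- by move=> x [n _ Cx] y Sxy; exists n.+1 => //; exists x.
Qed.

Lemma closed_separable_closure (T : topologicalType) (C : set T) :
  countable C -> closed_separable (closure C).
Proof.
move=> C_countable; split; first exact: closed_closure.
by exists C; split=> //; exact: subset_closure.
Qed.

Lemma closed_separable_closure_bigcup (T : topologicalType)
    (Y : nat -> set T) :
  (forall i, separable (Y i)) -> closed_separable (closure (\bigcup_i Y i)).
Proof.
move=> /choice[C CP]; split; first exact: closed_closure.
exists (\bigcup_i C i); split.
- by apply: bigcup_countable => // i _; have [] := CP i.
- apply: subset_trans (@subset_closure _ _).
  by apply: subset_bigcup => i _; have [] := CP i.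
- rewrite [X in _ `<=` X](closure_id _).1; last exact: closed_closure.
  apply: closure_subset => x [i _ Yx]; have [_ _ /(_ x Yx)] := CP i.
  by apply: closure_subset; exact: bigcup_sup.
Qed.

Lemma set_powerS (T : Type) (l : nat) (A B : set T) :
  A `<=` B -> @set_power T l A `<=` set_power B.
Proof. by move=> AB u Au i; exact/AB/Au. Qed.

(** The hypothesis on [D] compares suprema only at parameters in [Q]; the
    conclusion holds at all parameters, because [A11] supplies approximating
    parameters in [Q] at which a given feasible [u] stays feasible.  A single
    such approximation already yields a feasible point with entries in [D]; the
    inequality between the suprema then follows by passing to the limit along
    an approximation chosen separately for each [u]. *)
Lemma sup_attained_on_closure (R : realType) (X P : metricType R) (Q : set P)
    (l : nat) (G : X * P -> set ('I_l -> X))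
    (Phi : X * P -> ('I_l -> X) -> \bar R) (D : set X)
    (A11 : forall (x : X) (p : P),
      G (x, p) !=set0 /\
      forall (u : 'I_l -> X) (x_ : nat -> X),
        G (x, p) u -> x_ n @[n --> \oo] --> x ->
        exists p_ : nat -> P,
          [/\ forall n, Q (p_ n),
              p_ n @[n --> \oo] --> p
            & \forall n \near \oo,
                G (x_ n, p_ n) u /\ G (x_ n, p_ n) `<=` G (x, p)])
    (A21 : forall (z : X * P) (u : 'I_l -> X) (z_ : nat -> X * P),
      G z u -> z_ n @[n --> \oo] --> z ->
      Phi (z_ n) u @[n --> \oo] --> Phi z u)
    (A22 : forall (z : X * P) (A : set ('I_l -> X)) (z_ : nat -> X * P),
      A !=set0 -> A `&` G z !=set0 -> z_ n @[n --> \oo] --> z ->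
      (limn_esup (fun n => ereal_sup [set Phi (z_ n) u | u in A `&` G z])
        <= ereal_sup [set Phi z u | u in A `&` G z])%E) :
  (forall x q, D x -> Q q ->
    set_power D `&` G (x, q) !=set0 /\
    (ereal_sup [set Phi (x, q) u | u in G (x, q)] <=
     ereal_sup [set Phi (x, q) u | u in set_power D `&` G (x, q)])%E) ->
  forall x p, closure D x ->
    set_power (closure D) `&` G (x, p) !=set0 /\
    ereal_sup [set Phi (x, p) u | u in G (x, p)] =
    ereal_sup [set Phi (x, p) u | u in set_power (closure D) `&` G (x, p)].
Proof.
move=> DP x p Dx; have [x_ Dx_ x_x] := closure_cvg_seq _ _ _ _ Dx.
have powerD : @set_power X l D `<=` set_power (closure D).
  by apply: set_powerS; exact: subset_closure.
have [[u0 Gu0] approx] := A11 x p.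
have feasible : set_power (closure D) `&` G (x, p) !=set0.
  have [p_ [Qp_ _ [N _ /(_ N (leqnn N))[_ GN]]]] := approx u0 x_ Gu0 x_x.
  have [[v [Dv Gv]] _] := DP _ _ (Dx_ N) (Qp_ N).
  by exists v; split; [exact: powerD | exact: GN].
split=> //; apply/eqP; rewrite eq_le; apply/andP; split; last first.
  by apply: ereal_sup_le; apply: image_subset => u [].
apply: ge_ereal_sup => _ [u Gu <-].
have [p_ [Qp_ p_p nearG]] := approx u x_ Gu x_x.
pose z_ n := (x_ n, p_ n).
have z_z : z_ n @[n --> \oo] --> (x, p) by exact: cvg_pair.
have [_ <-] := cvg_limn_einf_sup (A21 (x, p) u z_ Gu z_z).
(* Since [A22] fixes [A] along the sequence, [A] must contain all the points
   that realise the suprema at [z_ n]; the tuples in [closure D] do. *)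
have [v [Dv _]] := feasible.
apply: le_trans (A22 (x, p) _ z_ (ex_intro _ v Dv) feasible z_z).
apply: le_limn_esup; apply: filterS nearG => n [Gnu GnG].
have [_ supD] := DP _ _ (Dx_ n) (Qp_ n).
apply: (@le_trans _ _ (ereal_sup [set Phi (z_ n) u | u in G (z_ n)])).
  by apply: ereal_sup_ubound; exists u.
apply: (le_trans supD); apply: ereal_sup_le; apply: image_subset.
by apply: setISS.
Qed.

Theorem theorem2p1 (R : realType) (X P : metricType R) (Q : set P) (l : nat)
    (G : X * P -> set ('I_l -> X)) (Phi : X * P -> ('I_l -> X) -> \bar R)
    (P_separable : separable [set: P])
    (Q_countable : countable Q) (Q_dense : dense Q)
    (l_ge1 : (1 <= l)%N)
    (Phi_gtNy : forall z u, Phi z u != -oo%E)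
    (A11 : forall (x : X) (p : P),
      G (x, p) !=set0 /\
      forall (u : 'I_l -> X) (x_ : nat -> X),
        G (x, p) u -> x_ n @[n --> \oo] --> x ->
        exists p_ : nat -> P,
          [/\ forall n, Q (p_ n),
              p_ n @[n --> \oo] --> p
            & \forall n \near \oo,
                G (x_ n, p_ n) u /\ G (x_ n, p_ n) `<=` G (x, p)])
    (A21 : forall (z : X * P) (u : 'I_l -> X) (z_ : nat -> X * P),
      G z u -> z_ n @[n --> \oo] --> z ->
      Phi (z_ n) u @[n --> \oo] --> Phi z u)
    (A22 : forall (z : X * P) (A : set ('I_l -> X)) (z_ : nat -> X * P),
      A !=set0 -> A `&` G z !=set0 -> z_ n @[n --> \oo] --> z ->
      (limn_esup (fun n => ereal_sup [set Phi (z_ n) u | u in A `&` G z])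
        <= ereal_sup [set Phi z u | u in A `&` G z])%E) :
  rich_family (sup_determining_family G Phi).
Proof.
have determining (D : set X) : closed_separable (closure D) ->
    (forall x q, D x -> Q q ->
      set_power D `&` G (x, q) !=set0 /\
      (ereal_sup [set Phi (x, q) u | u in G (x, q)] <=
       ereal_sup [set Phi (x, q) u | u in set_power D `&` G (x, q)])%E) ->
    sup_determining_family G Phi (closure D).
  move=> D_sep DP; split=> //.
  by move=> x p; exact: sup_attained_on_closure A11 A21 A22 DP x p.
split.
- by move=> Y [].
- move=> Y0 [C0 [C0_countable _ Y0C0]].
  (* On [C] and [Q] the supremum is attained because [C^l] contains
     [E (x, q)], which is why the entries of its points are added to [C0]. *)
  have /choice[E EP] (z : X * P) := countable_sup_attaining _ _ (Phi z) (G z)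
    (let: (x, p) := z return G z !=set0 in (A11 x p).1).
  have [|C [C_countable C0C CP]] := @countable_closed_under _
    (fun x => \bigcup_(q in Q) \bigcup_(u in E (x, q)) range u) C0 C0_countable.
    move=> x; apply: bigcup_countable => // q _.
    apply: bigcup_countable => [|u _]; first by have [] := EP (x, q).
    by apply: sub_countable (card_image_le _ _) _; exact: countableP.
  exists (closure C); last by apply: (subset_trans Y0C0); exact: closure_subset.
  apply: determining => [|x q Cx Qq]; first exact: closed_separable_closure.
  have [_ EG [u Eu] supE] := EP (x, q).
  have EC : E (x, q) `<=` set_power C `&` G (x, q).
    move=> v Ev; split; last exact: EG.
    by move=> i; apply: (CP x Cx); exists q => //; exists v => //; exists i.
  split; first by exists u; exact: EC.
  by apply: (le_trans supE); apply: ereal_sup_le; exact: image_subset.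
- move=> Y YP _; apply: determining => [|x q [i _ Yx] _].
    by apply: closed_separable_closure_bigcup => i; have [[]] := YP i.
  have [_ /(_ x q Yx)[[u [Yu Gu]] ->]] := YP i.
  have YiY := @set_powerS _ l _ _ (@bigcup_sup _ _ i setT Y I).
  split; first by exists u; split=> //; exact: YiY.
  by apply: ereal_sup_le; apply: image_subset; exact: setSI.
Qed.
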